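(* Every deduction in the natural deduction system $\mathbf{IPF}$ of intuitionist positive free logic can be transformed into a deduction in normal form, i.e. one containing neither maximal formulas nor maximal segments, with the same conclusion and with undischarged assumptions among those of the original deduction.
   Context: $\mathbf{IPF}$ is a natural deduction system for a first-order language without function symbols whose terms are constants and parameters (free variables), with a primitive one-place predicate $\exists!$ (read ''exists''), identity $=$, and connectives $\land,\lor,\rightarrow,\leftrightarrow,\bot,\forall,\exists$. $A^x_t$ denotes the result of replacing $x$ by $t$ in $A$. Rules: the standard intuitionist introduction and elimination rules for $\land$, $\rightarrow$, $\lor$ (with $\lor E$: from $A\lor B$, a deduction of $C$ from $A$ and a deduction of $C$ from $B$, infer $C$, discharging $A$ and $B$) and $\leftrightarrow$ ($\leftrightarrow I$: from a deduction of $B$ from $A$ and one of $A$ from $B$ infer $A\leftrightarrow B$ discharging both; $\leftrightarrow E$: from $A\leftrightarrow B$ and $A$ infer $B$, and from $A\leftrightarrow B$ and $B$ infer $A$); $\bot E$: from $\bot$ infer any atomic formula. $\forall I$: from a deduction of $A^x_a$ from assumptions including $\exists! a$, infer $\forall x A$, discharging $\exists!a$, where $a$ does not occur in $A$ nor in any other undischarged assumption. $\forall E$: from $\forall xA$ and $\exists!t$ infer $A^x_t$. $\exists I$: from $A^x_t$ and $\exists!t$ infer $\exists xA$. $\exists E$: from $\exists xA$ and a deduction of $C$ from $A^x_a$ and $\exists!a$, infer $C$ discharging $A^x_a,\exists!a$, where $a$ does not occur in $A$, $C$, or other undischarged assumptions. $=I$: $t=t$ is an axiom for every term $t$. $=E$: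 from $t_1=t_2$ and $A^x_{t_1}$ infer $A^x_{t_2}$, for atomic $A$ and distinct $t_1,t_2$. The major premise of an elimination rule is the premise containing the governed connective (the first premise listed). A maximal formula is a formula occurrence that is the conclusion of an introduction rule and the major premise of an elimination rule. The del-rules are $\lor E$ and $\exists E$. A segment is a sequence $C_1,\dots,C_n$ ($n\ge2$) of occurrences of the same formula such that $C_1$ is not the conclusion of a del-rule, $C_n$ is not a minor premise of a del-rule, and each $C_i$ ($i<n$) is a minor premise of a del-rule whose conclusion is $C_{i+1}$; it is maximal if $C_n$ is the major premise of an elimination rule. *)

(* Defs.v *)
From HB Require Import structures.
From mathcomp Require Import all_boot.

Set Implicit Arguments.
Unset Strict Implicit.
Unset Printing Implicit Defensive.

(* Bound variables and parameters are two disjoint, countably infinite sorts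
   of symbols, each represented by nat. *)

Record signature := Signature {
  constant : eqType;
  predicate : eqType;
  arity : predicate -> nat
}.

Inductive term (S : signature) : Type :=
| Par (a : nat)
| Cst (c : constant S).

Inductive qterm (S : signature) : Type :=
| Var (x : nat)
| Tm (t : term S).
Coercion Tm : term >-> qterm.

Arguments Par {S} a.
Arguments Var {S} x.

(* Raw expressions: bound variables may be free in them and predicates may be
   applied to the wrong number of arguments. The formulas proper are cut out
   by [formula] below. *)
Inductive form (S : signature) : Type :=
| Pred (P : predicate S) (ts : seq (qterm S))
| EBang (u : qterm S)      (* the existence predicate *)
| Eq (u v : qterm S)
| Bot
| And (A B : form S)
| Or (A B : form S)
| Imp (A B : form S)
| Iff (A B : form S)
| All (x : nat) (A : form S)
| Ex (x : nat) (A : form S).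

Arguments Bot {S}.

Lemma term_comparable (S : signature) : comparable (term S).
Proof.
move=> t u; rewrite /decidable.
decide equality; [exact: (decP eqP) | exact: (decP eqP)].
Defined.

HB.instance Definition _ (S : signature) :=
  hasDecEq.Build (term S) (compareP (@term_comparable S)).

Lemma qterm_comparable (S : signature) : comparable (qterm S).
Proof.
move=> t u; rewrite /decidable.
decide equality; [exact: (decP eqP) | exact: (decP eqP)].
Defined.

HB.instance Definition _ (S : signature) :=
  hasDecEq.Build (qterm S) (compareP (@qterm_comparable S)).

Lemma form_comparable (S : signature) : comparable (form S).
Proof.
move=> A B; rewrite /decidable.
decide equality; exact: (decP eqP).
Defined.

HB.instance Definition _ (S : signature) :=
  hasDecEq.Build (form S) (compareP (@form_comparable S)).

Definition qvars (S : signature) (u : qterm S) : seq nat :=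
  if u is Var x then [:: x] else [::].

Definition qpars (S : signature) (u : qterm S) : seq nat :=
  if u is Tm (Par a) then [:: a] else [::].

Fixpoint free_vars (S : signature) (A : form S) : seq nat :=
  match A with
  | Pred _ ts => flatten [seq qvars u | u <- ts]
  | EBang u => qvars u
  | Eq u v => qvars u ++ qvars v
  | Bot => [::]
  | And B C | Or B C | Imp B C | Iff B C => free_vars B ++ free_vars C
  | All x B | Ex x B => [seq y <- free_vars B | y != x]
  end.

Fixpoint pars (S : signature) (A : form S) : seq nat :=
  match A with
  | Pred _ ts => flatten [seq qpars u | u <- ts]
  | EBang u => qpars u
  | Eq u v => qpars u ++ qpars v
  | Bot => [::]
  | And B C | Or B C | Imp B C | Iff B C => pars B ++ pars C
  | All _ B | Ex _ B => pars B
  end.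

Fixpoint arity_ok (S : signature) (A : form S) : bool :=
  match A with
  | Pred P ts => size ts == arity P
  | EBang _ | Eq _ _ | Bot => true
  | And B C | Or B C | Imp B C | Iff B C => arity_ok B && arity_ok C
  | All _ B | Ex _ B => arity_ok B
  end.

Definition formula (S : signature) (A : form S) : bool :=
  arity_ok A && nilp (free_vars A).

Definition atomic (S : signature) (A : form S) : bool :=
  match A with Pred _ _ | EBang _ | Eq _ _ => true | _ => false end.

Definition qsubst (S : signature) (x : nat) (t : term S) (u : qterm S) :
    qterm S :=
  if u is Var y then (if y == x then Tm t else u) else u.

(* Only the free occurrences of x are replaced. No capture can occur, as terms
   contain no bound variables. *)
Fixpoint subst (S : signature) (x : nat) (t : term S) (A : form S) : form S :=
  match A with
  | Pred P ts => Pred P [seq qsubst x t u | u <- ts]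
  | EBang u => EBang (qsubst x t u)
  | Eq u v => Eq (qsubst x t u) (qsubst x t v)
  | Bot => Bot
  | And B C => And (subst x t B) (subst x t C)
  | Or B C => Or (subst x t B) (subst x t C)
  | Imp B C => Imp (subst x t B) (subst x t C)
  | Iff B C => Iff (subst x t B) (subst x t C)
  | All y B => if y == x then A else All y (subst x t B)
  | Ex y B => if y == x then A else Ex y (subst x t B)
  end.

(* An instance of a rule: the schematic letters of the rule, and one label
   (k, l) for each assumption class that the application discharges. *)
Inductive rule (S : signature) : Type :=
| AndI (A B : form S)
| AndE1 (A B : form S)
| AndE2 (A B : form S)
| OrI1 (A B : form S)
| OrI2 (A B : form S)
| OrE (A B C : form S) (k l : nat)
| ImpI (A B : form S) (k : nat)
| ImpE (A B : form S)
| IffI (A B : form S) (k l : nat)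
| IffE1 (A B : form S)
| IffE2 (A B : form S)
| BotE (A : form S)
| AllI (x : nat) (A : form S) (a k : nat)
| AllE (x : nat) (A : form S) (t : term S)
| ExI (x : nat) (A : form S) (t : term S)
| ExE (x : nat) (A C : form S) (a k l : nat)
| EqI (t : term S)
| EqE (x : nat) (A : form S) (t1 t2 : term S).

Definition rule_concl (S : signature) (r : rule S) : form S :=
  match r with
  | AndI A B => And A B
  | AndE1 A _ => A
  | AndE2 _ B => B
  | OrI1 A B | OrI2 A B => Or A B
  | OrE _ _ C _ _ => C
  | ImpI A B _ => Imp A B
  | ImpE _ B => B
  | IffI A B _ _ => Iff A B
  | IffE1 _ B => B
  | IffE2 A _ => A
  | BotE A => A
  | AllI x A _ _ => All x A
  | AllE x A t => subst x t A
  | ExI x A _ => Ex x A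
  | ExE _ _ C _ _ _ => C
  | EqI t => Eq t t
  | EqE x A _ t2 => subst x t2 A
  end.

(* The major premise of an elimination rule comes first. *)
Definition rule_prems (S : signature) (r : rule S) : seq (form S) :=
  match r with
  | AndI A B => [:: A; B]
  | AndE1 A B | AndE2 A B => [:: And A B]
  | OrI1 A _ => [:: A]
  | OrI2 _ B => [:: B]
  | OrE A B C _ _ => [:: Or A B; C; C]
  | ImpI _ B _ => [:: B]
  | ImpE A B => [:: Imp A B; A]
  | IffI A B _ _ => [:: B; A]
  | IffE1 A B => [:: Iff A B; A]
  | IffE2 A B => [:: Iff A B; B]
  | BotE _ => [:: Bot]
  | AllI x A a _ => [:: subst x (Par a) A]
  | AllE x A t => [:: All x A; EBang t]
  | ExI x A t => [:: subst x t A; EBang t]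
  | ExE x A C _ _ _ => [:: Ex x A; C]
  | EqI _ => [::]
  | EqE x A t1 t2 => [:: Eq t1 t2; subst x t1 A]
  end.

(* An assumption class is a label together with a formula. *)
Notation assumption S := (nat * form S)%type.

(* For each premise, the assumption classes discharged in its deduction. *)
Definition rule_disch (S : signature) (r : rule S) :
    seq (seq (assumption S)) :=
  match r with
  | OrE A B _ k l => [:: [::]; [:: (k, A)]; [:: (l, B)]]
  | ImpI A _ k => [:: [:: (k, A)]]
  | IffI A B k l => [:: [:: (k, A)]; [:: (l, B)]]
  | AllI _ _ a k => [:: [:: (k, EBang (Par a))]]
  | ExE x A _ a k l =>
      [:: [::]; [:: (k, subst x (Par a) A); (l, EBang (Par a))]]
  | _ => [seq [::] | _ <- rule_prems r]
  end.

Definition fresh_in (S : signature) (a : nat) (hs : seq (assumption S)) : bool :=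
  all (fun h => a \notin pars h.2) hs.

(* Here [others] lists, for each premise, the assumptions that are left
   undischarged in its deduction by the application of the rule. *)
Definition rule_side (S : signature) (r : rule S)
    (others : seq (seq (assumption S))) : bool :=
  match r with
  | BotE A => atomic A
  | AllI _ A a _ => (a \notin pars A) && fresh_in a (nth [::] others 0)
  | ExE _ A C a _ _ =>
      [&& a \notin pars A, a \notin pars C & fresh_in a (nth [::] others 1)]
  | EqE _ A t1 t2 => atomic A && (t1 != t2)
  | _ => true
  end.

Inductive tree (S : signature) : Type :=
| Assume (k : nat) (A : form S)
| Infer (r : rule S) (ds : seq (tree S)).

Definition concl (S : signature) (D : tree S) : form S :=
  match D with Assume _ A => A | Infer r _ => rule_concl r end.

Definition discharge (S : signature) (r : rule S)
    (us : seq (seq (assumption S))) : seq (seq (assumption S)) :=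
  [seq [seq h <- p.1 | h \notin p.2] | p <- zip us (rule_disch r)].

Fixpoint undischarged (S : signature) (D : tree S) : seq (assumption S) :=
  match D with
  | Assume k A => [:: (k, A)]
  | Infer r ds => flatten (discharge r [seq undischarged d | d <- ds])
  end.

Definition undischarged_formulas (S : signature) (D : tree S) : seq (form S) :=
  [seq h.2 | h <- undischarged D].

Fixpoint deduction (S : signature) (D : tree S) : bool :=
  match D with
  | Assume _ A => formula A
  | Infer r ds =>
      [&& formula (rule_concl r),
          [seq concl d | d <- ds] == rule_prems r,
          rule_side r (discharge r [seq undischarged d | d <- ds])
        & all (@deduction S) ds]
  end.

Definition is_intro (S : signature) (r : rule S) : bool :=
  match r with
  | AndI _ _ | OrI1 _ _ | OrI2 _ _ | ImpI _ _ _ | IffI _ _ _ _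
  | AllI _ _ _ _ | ExI _ _ _ | EqI _ => true
  | _ => false
  end.

Definition is_elim (S : signature) (r : rule S) : bool := ~~ is_intro r.

Definition is_del (S : signature) (r : rule S) : bool :=
  match r with OrE _ _ _ _ _ | ExE _ _ _ _ _ _ => true | _ => false end.

(* A formula occurrence is given by its path from the root of the tree: the
   i-th premise of the inference concluding occurrence p is [rcons p i]. *)
Definition occurrence := seq nat.

Fixpoint subtree (S : signature) (D : tree S) (p : occurrence) :
    option (tree S) :=
  match p, D with
  | [::], _ => Some D
  | i :: p', Infer _ ds => obind (fun d => subtree d p') (onth ds i)
  | _ :: _, Assume _ _ => None
  end.

Definition formula_at (S : signature) (D : tree S) (p : occurrence) :
    option (form S) :=
  omap (@concl S) (subtree D p).

Definition concluded_by (S : signature) (D : tree S) (p : occurrence)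
    (R : rule S -> bool) : bool :=
  if subtree D p is Some (Infer r _) then R r else false.

Definition major_premise (S : signature) (D : tree S) (p : occurrence) : Prop :=
  exists2 q, p = rcons q 0 & concluded_by D q (@is_elim S).

(* p is a minor premise of an application of a del-rule with conclusion q *)
Definition del_minor_premise (S : signature) (D : tree S) (p q : occurrence) :
    Prop :=
  exists2 i, p = rcons q i.+1 & concluded_by D q (@is_del S).

Definition maximal_formula (S : signature) (D : tree S) (p : occurrence) :
    Prop :=
  concluded_by D p (@is_intro S) /\ major_premise D p.

Definition segment (S : signature) (D : tree S) (s : seq occurrence) : Prop :=
  [/\ 1 < size s,
      exists A, forall p, p \in s -> formula_at D p = Some A,
      ~~ concluded_by D (head [::] s) (@is_del S),
      (forall q, ~ del_minor_premise D (last [::] s) q)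
    & forall i, i.+1 < size s ->
        del_minor_premise D (nth [::] s i) (nth [::] s i.+1)].

Definition maximal_segment (S : signature) (D : tree S) (s : seq occurrence) :
    Prop :=
  segment D s /\ major_premise D (last [::] s).

Definition normal (S : signature) (D : tree S) : Prop :=
  (forall p, ~ maximal_formula D p) /\ (forall s, ~ maximal_segment D s).

(* Main.v *)
Require Import Defs.
From mathcomp Require Import all_boot.

Set Implicit Arguments.
Unset Strict Implicit.
Unset Printing Implicit Defensive.

(** Normalization by evaluation. Normal deductions are captured by a calculus
    [prf] over sets of assumptions, split into neutral deductions (assumptions
    and non-del eliminations whose major premise is neutral) and normal ones.
    Its assumption sets are the worlds of a Kripke model in which atomic formulas
    are forced when they have a normal deduction, and disjunctions and existential
    formulas are interpreted by a continuation semantics. Every deduction is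
    sound in this model under all substitutions for parameters, every neutral
    deduction forces its conclusion, and every forced formula has a normal
    deduction. Applying soundness at the world of the undischarged assumptions
    gives the theorem; no reduction of deductions is ever performed. *)

(** * Substitution *)

Definition tpsubst (S : signature) (s : nat -> term S) (t : term S) : term S :=
  match t with Par a => s a | Cst c => Cst c end.

Definition qpsubst (S : signature) (s : nat -> term S) (u : qterm S) : qterm S :=
  match u with Var x => Var x | Tm t => Tm (tpsubst s t) end.

Fixpoint psubst (S : signature) (s : nat -> term S) (A : form S) : form S :=
  match A with
  | Pred P ts => Pred P [seq qpsubst s u | u <- ts]
  | EBang u => EBang (qpsubst s u)
  | Eq u v => Eq (qpsubst s u) (qpsubst s v)
  | Bot => Bot
  | And B C => And (psubst s B) (psubst s C)
  | Or B C => Or (psubst s B) (psubst s C)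
  | Imp B C => Imp (psubst s B) (psubst s C)
  | Iff B C => Iff (psubst s B) (psubst s C)
  | All x B => All x (psubst s B)
  | Ex x B => Ex x (psubst s B)
  end.

Definition upd (S : signature) (s : nat -> term S) (a : nat) (t : term S) :
    nat -> term S :=
  fun b => if b == a then t else s b.

Lemma qvars_qsubst (S : signature) x (t : term S) u :
  qvars (qsubst x t u) = [seq y <- qvars u | y != x].
Proof. by case: u => [y|u] //=; case: eqP. Qed.

Lemma free_vars_subst (S : signature) x (t : term S) A :
  free_vars (subst x t A) = [seq y <- free_vars A | y != x].
Proof.
elim: A => [P ts|u|u v||B IB C IC|B IB C IC|B IB C IC|B IB C IC|y B IB|y B IB] /=;
  rewrite ?filter_cat ?qvars_qsubst ?IB ?IC //.
- by elim: ts => //= u ts IH; rewrite filter_cat qvars_qsubst IH.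
- case: eqP => [->|_] /=; first by rewrite filter_id.
  by rewrite IB -!filter_predI; apply: eq_filter => z /=; rewrite andbC.
- case: eqP => [->|_] /=; first by rewrite filter_id.
  by rewrite IB -!filter_predI; apply: eq_filter => z /=; rewrite andbC.
Qed.

Lemma arity_ok_subst (S : signature) x (t : term S) A :
  arity_ok (subst x t A) = arity_ok A.
Proof.
elim: A => [P ts|u|u v||B IB C IC|B IB C IC|B IB C IC|B IB C IC|y B IB|y B IB] /=;
  rewrite ?IB ?IC ?size_map //; by case: eqP => //= _; rewrite IB.
Qed.

(** [All x A] on the right says, without mention of [t], that arities are correct and at most [x] is
    free; so one instance of [A] is a formula exactly when every other is. *)
Lemma formula_subst (S : signature) x (t : term S) A :
  formula (subst x t A) = formula (All x A).
Proof. by rewrite /formula /= arity_ok_subst free_vars_subst. Qed.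

Lemma formula_Ex (S : signature) x (A : form S) : formula (Ex x A) = formula (All x A).
Proof. by []. Qed.

Lemma formula_bin (S : signature) (A B : form S) :
  [/\ formula (And A B) = formula A && formula B,
      formula (Or A B) = formula A && formula B,
      formula (Imp A B) = formula A && formula B
    & formula (Iff A B) = formula A && formula B].
Proof.
have E : (arity_ok A && arity_ok B) && nilp (free_vars A ++ free_vars B) =
  formula A && formula B by rewrite cat_nilp /formula andbACA.
by split.
Qed.

Lemma formula_And (S : signature) (A B : form S) :
  formula (And A B) = formula A && formula B.
Proof. by case: (formula_bin A B). Qed.

Lemma formula_Or (S : signature) (A B : form S) :
  formula (Or A B) = formula A && formula B.
Proof. by case: (formula_bin A B). Qed.

Lemma formula_Imp (S : signature) (A B : form S) :
  formula (Imp A B) = formula A && formula B.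
Proof. by case: (formula_bin A B). Qed.

Lemma formula_Iff (S : signature) (A B : form S) :
  formula (Iff A B) = formula A && formula B.
Proof. by case: (formula_bin A B). Qed.

Lemma atomic_subst (S : signature) x (t : term S) A : atomic (subst x t A) = atomic A.
Proof. by case: A => //= y A; case: eqP. Qed.

Lemma atomic_psubst (S : signature) (s : nat -> term S) A :
  atomic (psubst s A) = atomic A.
Proof. by case: A. Qed.

Lemma formula_psubst (S : signature) (s : nat -> term S) A :
  formula (psubst s A) = formula A.
Proof.
have qv u : qvars (qpsubst s u) = qvars u by case: u.
have ea : arity_ok (psubst s A) = arity_ok A.
  elim: A => [P ts|u|u v||B IB C IC|B IB C IC|B IB C IC|B IB C IC|y B IB|y B IB] /=;
    by rewrite ?IB ?IC ?size_map.
have ef : free_vars (psubst s A) = free_vars A.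
  elim: A {ea} => [P ts|u|u v||B IB C IC|B IB C IC|B IB C IC|B IB C IC|y B IB|y B IB] /=;
    rewrite ?IB ?IC ?qv //.
  by rewrite -map_comp; congr flatten; apply: eq_map => u /=; rewrite qv.
by rewrite /formula ea ef.
Qed.

Lemma psubst_subst (S : signature) (s : nat -> term S) x t A :
  psubst s (subst x t A) = subst x (tpsubst s t) (psubst s A).
Proof.
have qs u : qpsubst s (qsubst x t u) = qsubst x (tpsubst s t) (qpsubst s u).
  by case: u => //= y; case: eqP.
elim: A => [P ts|u|u v||B IB C IC|B IB C IC|B IB C IC|B IB C IC|y B IB|y B IB] /=;
  rewrite ?IB ?IC ?qs //.
- by congr Pred; rewrite -!map_comp; apply: eq_map => u /=; rewrite qs.
- by case: eqP => //= _; rewrite IB.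
- by case: eqP => //= _; rewrite IB.
Qed.

Lemma eq_psubst (S : signature) (s s' : nat -> term S) A :
  {in pars A, s =1 s'} -> psubst s A = psubst s' A.
Proof.
have qs u : {in qpars u, s =1 s'} -> qpsubst s u = qpsubst s' u.
  by case: u => [y|[a|c]] //= -> //; rewrite inE.
elim: A => [P ts|u|u v||B IB C IC|B IB C IC|B IB C IC|B IB C IC|y B IB|y B IB] /= H //;
  rewrite ?IB ?IC ?qs //; try by move=> a Ha; apply: H; rewrite ?mem_cat Ha ?orbT.
congr Pred; apply/eq_in_map => u Hu; apply: qs => a Ha; apply: H.
by apply/flatten_mapP; exists u.
Qed.

Lemma psubst_upd (S : signature) (s : nat -> term S) a t A :
  a \notin pars A -> psubst (upd s a t) A = psubst s A.
Proof.
move=> aA; apply: eq_psubst => b bA; rewrite /upd; case: eqP => // E.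
by rewrite -E bA in aA.
Qed.

(** Reinterpreting the eigenparameter [a] as [t] turns the instance of [A] at [a] into the instance
    at [t]; this is how the rules with eigenparameters are evaluated. *)
Lemma psubst_upd_subst (S : signature) (s : nat -> term S) x a t A :
  a \notin pars A ->
  psubst (upd s a t) (subst x (Par a) A) = subst x t (psubst s A).
Proof. by move=> aA; rewrite psubst_subst psubst_upd //= /upd eqxx. Qed.

Lemma psubst_id (S : signature) (A : form S) : psubst Par A = A.
Proof.
have qs (u : qterm S) : qpsubst Par u = u by case: u => // -[].
elim: A => [P ts|u|u v||B IB C IC|B IB C IC|B IB C IC|B IB C IC|y B IB|y B IB] /=;
  rewrite ?IB ?IC ?qs //.
by rewrite (eq_map qs) map_id.
Qed.

Lemma ex_fresh (L : seq nat) : exists a, a \notin L.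
Proof.
exists (\max_(i <- L) i).+1; apply/negP => H.
by have := @leq_bigmax_seq _ L xpredT id _ H isT; rewrite ltnn.
Qed.

(** * Normal deductions over sets of assumptions *)

(* [prf true] is the neutral judgement, [prf false] the normal one. Eigenparameters
   range over all parameters outside a finite list [L], so that weakening needs
   no renaming. *)
Inductive prf (S : signature) : bool -> seq (form S) -> form S -> Prop :=
| prf_assume G A : A \in G -> prf true G A
| prf_andE1 G A B : prf true G (And A B) -> prf true G A
| prf_andE2 G A B : prf true G (And A B) -> prf true G B
| prf_impE G A B : prf true G (Imp A B) -> prf false G A -> prf true G B
| prf_iffE1 G A B : prf true G (Iff A B) -> prf false G A -> prf true G B
| prf_iffE2 G A B : prf true G (Iff A B) -> prf false G B -> prf true G A
| prf_botE G A : atomic A -> formula A -> prf true G Bot -> prf true G A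
| prf_allE G x A (t : term S) :
    prf true G (All x A) -> prf false G (EBang t) -> prf true G (subst x t A)
| prf_eqE G x A (t1 t2 : term S) :
    atomic A -> t1 != t2 -> prf true G (Eq t1 t2) ->
    prf false G (subst x t1 A) -> prf true G (subst x t2 A)
| prf_neutral G A : prf true G A -> prf false G A
| prf_andI G A B : prf false G A -> prf false G B -> prf false G (And A B)
| prf_orI1 G A B : formula B -> prf false G A -> prf false G (Or A B)
| prf_orI2 G A B : formula A -> prf false G B -> prf false G (Or A B)
| prf_impI G A B : formula A -> prf false (A :: G) B -> prf false G (Imp A B)
| prf_iffI G A B :
    formula A -> formula B -> prf false (A :: G) B -> prf false (B :: G) A ->
    prf false G (Iff A B)
| prf_allI G (L : seq nat) x A :
    (forall a, a \notin L ->
       prf false (EBang (Par a) :: G) (subst x (Par a) A)) ->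
    prf false G (All x A)
| prf_exI G x A (t : term S) :
    prf false G (subst x t A) -> prf false G (EBang t) -> prf false G (Ex x A)
| prf_eqI G (t : term S) : prf false G (Eq t t)
| prf_orE G A B C :
    prf true G (Or A B) -> prf false (A :: G) C -> prf false (B :: G) C ->
    prf false G C
| prf_exE G (L : seq nat) x A C :
    prf true G (Ex x A) ->
    (forall a, a \notin L ->
       prf false [:: subst x (Par a) A, EBang (Par a) & G] C) ->
    prf false G C.

Lemma subset_cons2 (T : eqType) (x : T) (G H : seq T) :
  {subset G <= H} -> {subset x :: G <= x :: H}.
Proof. by move=> s y; rewrite !inE => /orP[->//|/s->]; rewrite orbT. Qed.

Lemma subset_consr (T : eqType) (x : T) (G : seq T) : {subset G <= x :: G}.
Proof. by move=> y; rewrite inE => ->; rewrite orbT. Qed.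

Lemma prf_weak (S : signature) b (G H : seq (form S)) A :
  prf b G A -> {subset G <= H} -> prf b H A.
Proof.
move=> p; elim: p H => {b G A}.
- by move=> G A AG H s; apply: prf_assume; apply: s.
- by move=> G A B _ IH H s; apply: prf_andE1 (IH _ s).
- by move=> G A B _ IH H s; apply: prf_andE2 (IH _ s).
- by move=> G A B _ IH _ IH' H s; apply: prf_impE (IH _ s) (IH' _ s).
- by move=> G A B _ IH _ IH' H s; apply: prf_iffE1 (IH _ s) (IH' _ s).
- by move=> G A B _ IH _ IH' H s; apply: prf_iffE2 (IH _ s) (IH' _ s).
- by move=> G A a f _ IH H s; apply: prf_botE (IH _ s).
- by move=> G x A t _ IH _ IH' H s; apply: prf_allE (IH _ s) (IH' _ s).
- by move=> G x A t1 t2 a n _ IH _ IH' H s; apply: prf_eqE (IH _ s) (IH' _ s).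
- by move=> G A _ IH H s; apply: prf_neutral (IH _ s).
- by move=> G A B _ IH _ IH' H s; apply: prf_andI (IH _ s) (IH' _ s).
- by move=> G A B f _ IH H s; apply: prf_orI1 (IH _ s).
- by move=> G A B f _ IH H s; apply: prf_orI2 (IH _ s).
- by move=> G A B f _ IH H s; apply: prf_impI f (IH _ (subset_cons2 s)).
- move=> G A B f g _ IH _ IH' H s.
  exact: prf_iffI f g (IH _ (subset_cons2 s)) (IH' _ (subset_cons2 s)).
- move=> G L x A _ IH H s; apply: (@prf_allI _ _ L) => a aL.
  exact: IH aL _ (subset_cons2 s).
- by move=> G x A t _ IH _ IH' H s; apply: prf_exI (IH _ s) (IH' _ s).
- by move=> G t H _; apply: prf_eqI.
- move=> G A B C _ IH _ IH1 _ IH2 H s.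
  exact: prf_orE (IH _ s) (IH1 _ (subset_cons2 s)) (IH2 _ (subset_cons2 s)).
- move=> G L x A C _ IH _ IH' H s; apply: (@prf_exE _ _ L _ _ _ (IH _ s)) => a aL.
  exact: IH' aL _ (subset_cons2 (subset_cons2 s)).
Qed.

(** The major premises of [BotE] and of [EqE] between distinct terms. No introduction rule concludes
    them, so a normal deduction of one leads, through del-rules only, up to neutral deductions of
    it. *)
Definition unintroducible (S : signature) (A : form S) : bool :=
  match A with Bot => true | Eq u v => u != v | _ => false end.

(* Permutes an elimination of [A] above the del-rules that end the deduction. *)
Lemma prf_bind (S : signature) (G : seq (form S)) A C :
  prf false G A -> unintroducible A ->
  (forall H, {subset G <= H} -> prf true H A -> prf false H C) -> prf false G C.
Proof.
move: {-1}false (erefl false) => b eb p; elim: p eb => {b G A} //.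
- by move=> G A p _ _ _ K; apply: K p.
- by move=> G t _ /=; rewrite eqxx.
- move=> G A B D p _ _ IH1 _ IH2 _ u K; apply: prf_orE p _ _.
    by apply: IH1 => // H s; apply: K => A' /subset_consr/s.
  by apply: IH2 => // H s; apply: K => A' /subset_consr/s.
- move=> G L x A D p _ _ IH _ u K; apply: (@prf_exE _ _ L _ _ _ p) => a aL.
  by apply: IH => // H s; apply: K => A' /subset_consr/subset_consr/s.
Qed.

Lemma prf_botE_normal (S : signature) (G : seq (form S)) A :
  atomic A -> formula A -> prf false G Bot -> prf false G A.
Proof.
move=> aA fA p; apply: prf_bind p _ _ => // H _ p.
exact/prf_neutral/prf_botE.
Qed.

Lemma prf_eqE_normal (S : signature) (G : seq (form S)) x A (t1 t2 : term S) :
  atomic A -> prf false G (Eq t1 t2) -> prf false G (subst x t1 A) ->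
  prf false G (subst x t2 A).
Proof.
(* A substitution for parameters may identify distinct terms; the second premise is then already the
   conclusion. *)
move=> aA p q; have [<-//|n] := eqVneq t1 t2.
apply: prf_bind p _ _ => [|H s p]; first by apply: contra_neq n => -[].
exact: prf_neutral (prf_eqE aA n p (prf_weak q s)).
Qed.

(** * The Kripke model *)

Inductive shape := SAtom | SBin (s1 s2 : shape) | SQuant (s : shape).

Fixpoint shape_of (S : signature) (A : form S) : shape :=
  match A with
  | And B C | Or B C | Imp B C | Iff B C => SBin (shape_of B) (shape_of C)
  | All _ B | Ex _ B => SQuant (shape_of B)
  | _ => SAtom
  end.

(** A continuation monad whose answers are normal deductions of arbitrary [C], in the manner of Beth
    covers. A neutral disjunction or existential formula supplies such a cover by [prf_orE] or
    [prf_exE], without deciding which case or witness holds. Quantifying over [H] builds in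
    monotonicity. *)
Definition cover (S : signature) (P : seq (form S) -> Prop) (G : seq (form S)) :
    Prop :=
  forall H C, {subset G <= H} ->
    (forall I, {subset H <= I} -> P I -> prf false I C) -> prf false H C.

(* Substitution instances are not subterms, but they have the same shape, which
   makes the recursion structural. *)
Fixpoint force (S : signature) (s : shape) (A : form S) (G : seq (form S)) : Prop :=
  match s, A with
  | SBin s1 s2, And B C => force s1 B G /\ force s2 C G
  | SBin s1 s2, Or B C => cover (fun H => force s1 B H \/ force s2 C H) G
  | SBin s1 s2, Imp B C =>
      forall H, {subset G <= H} -> force s1 B H -> force s2 C H
  | SBin s1 s2, Iff B C =>
      forall H, {subset G <= H} ->
        (force s1 B H -> force s2 C H) /\ (force s2 C H -> force s1 B H)
  | SQuant s, All x B =>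
      forall H (t : term S), {subset G <= H} -> prf false H (EBang t) ->
        force s (subst x t B) H
  | SQuant s, Ex x B =>
      cover (fun H => exists t : term S,
                        prf false H (EBang t) /\ force s (subst x t B) H) G
  | _, _ => prf false G A
  end.

(** At its own shape a formula falls under the default clause of [force] only if it is atomic or
    [Bot]. *)
Definition forces (S : signature) (A : form S) (G : seq (form S)) : Prop :=
  force (shape_of A) A G.

Lemma shape_of_subst (S : signature) x (t : term S) A :
  shape_of (subst x t A) = shape_of A.
Proof.
by elim: A => //= [B -> C ->|B -> C ->|B -> C ->|B -> C ->|y B IB|y B IB] //;
  case: eqP => //= _; rewrite IB.
Qed.

Lemma forces_atomic (S : signature) (A : form S) G :
  atomic A -> forces A G = prf false G A.
Proof. by case: A. Qed.

Lemma subset_trans_seq (T : eqType) (G H I : seq T) :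
  {subset G <= H} -> {subset H <= I} -> {subset G <= I}.
Proof. by move=> s s' x /s/s'. Qed.

Lemma force_weak (S : signature) s (A : form S) G H :
  force s A G -> {subset G <= H} -> force s A H.
Proof.
elim: s A => [|s1 I1 s2 I2|s IH] A /=.
- by move=> p s; case: A p => *; apply: prf_weak s.
- case: A => [P ts|u|u v||B C|B C|B C|B C|y B|y B]; try exact: prf_weak.
  + by move=> [p q] sb; split; [apply: I1|apply: I2].
  + by move=> p sb I C' sb'; apply: p; apply: subset_trans_seq sb'.
  + by move=> p sb I sb'; apply: p; apply: subset_trans_seq sb'.
  + by move=> p sb I sb'; apply: p; apply: subset_trans_seq sb'.
- case: A => [P ts|u|u v||B C|B C|B C|B C|y B|y B]; try exact: prf_weak.
  + by move=> p sb I t sb'; apply: p; apply: subset_trans_seq sb'.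
  + by move=> p sb I C' sb'; apply: p; apply: subset_trans_seq sb'.
Qed.

Lemma forces_weak (S : signature) (A : form S) G H :
  forces A G -> {subset G <= H} -> forces A H.
Proof. exact: force_weak. Qed.

Lemma forces_AllE (S : signature) x (A : form S) G (t : term S) :
  forces (All x A) G -> prf false G (EBang t) -> forces (subst x t A) G.
Proof. by move=> p q; rewrite /forces shape_of_subst; apply: p. Qed.

Lemma cover_weak (S : signature) P (G H : seq (form S)) :
  cover P G -> {subset G <= H} -> cover P H.
Proof. by move=> c s I C s'; apply: c; apply: subset_trans_seq s'. Qed.

(** Covers can be eliminated into any forced formula, not only into normal deductions: the cover is
    pushed down to atoms, disjunctions and existential formulas, which absorb it. Soundness of the
    del-rules rests on this. *)
Lemma cover_force (S : signature) (P : seq (form S) -> Prop) s A G :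
  cover P G -> (forall H, {subset G <= H} -> P H -> force s A H) -> force s A G.
Proof.
(* The formula to be deduced serves as the answer of the continuation. *)
have base B G' : cover P G' ->
    (forall H, {subset G' <= H} -> P H -> prf false H B) -> prf false G' B.
  by move=> c; apply: c.
(* Covers compose: this is the multiplication of the monad. *)
have bind Q G' : cover P G' ->
    (forall H, {subset G' <= H} -> P H -> cover Q H) -> cover Q G'.
  move=> c K H C s1 k; apply: c => // I s2 PI.
  have sI := subset_trans_seq s1 s2; apply: (K _ sI PI) => // J s3.
  by apply: k; apply: subset_trans_seq s3.
elim: s A G => [|s1 I1 s2 I2|s IH] A G c /=; first by case: A => *; apply: base.
- case: A => [Q ts|u|u v||B C|B C|B C|B C|y B|y B]; try exact: base.
  + by move=> K; split; [apply: I1|apply: I2] => // H s /(K _ s) [].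
  + exact: bind.
  + move=> K H s f; apply: (I2 _ _ (cover_weak c s)) => I s' PI.
    by apply: (K I) (force_weak f s') => //; apply: subset_trans_seq s'.
  + move=> K H s; split=> f.
      apply: (I2 _ _ (cover_weak c s)) => I s' PI.
      have [g _] := K I (subset_trans_seq s s') PI I (fun x => id).
      exact: g (force_weak f s').
    apply: (I1 _ _ (cover_weak c s)) => I s' PI.
    have [_ g] := K I (subset_trans_seq s s') PI I (fun x => id).
    exact: g (force_weak f s').
- case: A => [Q ts|u|u v||B C|B C|B C|B C|y B|y B]; try exact: base.
  + move=> K H t sb p; apply: (IH _ _ (cover_weak c sb)) => I s' PI.
    apply: (K I) (prf_weak p s') => //; exact: subset_trans_seq s'.
  + exact: bind.
Qed.

Lemma cover_forces (S : signature) (P : seq (form S) -> Prop) A G :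
  cover P G -> (forall H, {subset G <= H} -> P H -> forces A H) -> forces A G.
Proof. exact: cover_force. Qed.

(** Reification and reflection are proved together because implication exchanges them: reifying it
    reflects the assumed antecedent, and reflecting it reifies the argument. Induction on the shape
    puts all instances of a quantified formula within reach of the induction hypothesis. *)
Lemma reify_reflect (S : signature) (A : form S) :
  formula A ->
  forall G, (forces A G -> prf false G A) /\ (prf true G A -> forces A G).
Proof.
move E: (shape_of A) => s; elim: s A E => [|s1 I1 s2 I2|s IH] A E fA G.
- by rewrite /forces E /=; case: A {E fA} => *; split=> //; apply: prf_neutral.
- case: A E fA => //= B C [E1 E2];
  rewrite ?(formula_And, formula_Or, formula_Imp, formula_Iff) => /andP[fB fC];
  rewrite /forces /= -/(forces B) -/(forces C);
  have rB H := proj1 (I1 _ E1 fB H); have uB H := proj2 (I1 _ E1 fB H);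
  have rC H := proj1 (I2 _ E2 fC H); have uC H := proj2 (I2 _ E2 fC H);
  (* An assumed subformula is neutral, hence forced in the world extended by it. *)
  have aB H : forces B (B :: H) by [apply/uB/prf_assume; rewrite mem_head];
  have aC H : forces C (C :: H) by [apply/uC/prf_assume; rewrite mem_head].
  + split=> [[p q]|p]; first by apply: prf_andI; [apply: rB|apply: rC].
    by split; [apply/uB/(prf_andE1 p)|apply/uC/(prf_andE2 p)].
  + split=> [p|p].
      (* The continuation is run with the disjunction itself as its answer. *)
      apply: p => // H s [q|q]; first by apply: prf_orI1 => //; apply: rB.
      by apply: prf_orI2 => //; apply: rC.
    (* The neutral disjunction is eliminated with the arbitrary answer [D] as conclusion, which the
       continuation deduces in each branch. *)
    move=> H D s K; apply: prf_orE (prf_weak p s) _ _; apply: K;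
      by [exact: subset_consr|left; exact: aB|right; exact: aC].
  + split=> [p|p].
      by apply: prf_impI => //; apply: rC; apply: p (aB G); apply: subset_consr.
    by move=> H s q; apply/uC/(prf_impE (prf_weak p s))/rB.
  + split=> [p|p].
      apply: prf_iffI => //.
        by apply/rC/(proj1 (p _ _) (aB G))/subset_consr.
      by apply/rB/(proj2 (p _ _) (aC G))/subset_consr.
    move=> H s; split=> q; first exact/uC/(prf_iffE1 (prf_weak p s))/rB.
    exact/uB/(prf_iffE2 (prf_weak p s))/rC.
- case: A E fA => //= x B [E] fA; rewrite /forces /=;
  have {}IH t := IH (subst x t B) (etrans (shape_of_subst x t B) E)
    (etrans (formula_subst x t B) fA);
  have rB t H := proj1 (IH t H); have uB t H := proj2 (IH t H);
  have Es t : force (shape_of B) (subst x t B) = forces (subst x t B)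
    by [rewrite /forces shape_of_subst].
  + split=> [p|p].
      (* [p] accepts every parameter that the added assumption makes exist, so the list of excluded
         parameters is empty. *)
      apply: (@prf_allI _ _ [::]) => a _; apply: rB.
      rewrite -Es; apply: p; first exact: subset_consr.
      by apply/prf_neutral/prf_assume; rewrite mem_head.
    by move=> H t sb q; rewrite Es; apply/uB/(prf_allE (prf_weak p sb)).
  + split=> [p|p].
      by apply: p => // H sb [t [q]]; rewrite Es => /rB r; apply: prf_exI r q.
    move=> H D sb K; apply: (@prf_exE _ _ [::]); first exact: prf_weak p sb.
    move=> a _; apply: K; first by move=> y /subset_consr/subset_consr.
    exists (Par a); split.
      by apply/prf_neutral/prf_assume; rewrite !inE eqxx orbT.
    by rewrite Es; apply/uB/prf_assume; rewrite mem_head.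
Qed.

Lemma forces_prf (S : signature) (A : form S) G :
  formula A -> forces A G -> prf false G A.
Proof. by move=> fA; case: (reify_reflect fA G). Qed.

Lemma prf_forces (S : signature) (A : form S) G :
  formula A -> prf true G A -> forces A G.
Proof. by move=> fA; case: (reify_reflect fA G). Qed.

(** * Soundness *)

(** The premises form a list, so the induction hypothesis is a conjunction over it that computes to
    one conjunct per premise once the list is known. *)
Lemma tree_nested_ind (S : signature) (P : tree S -> Prop) :
  (forall k A, P (Assume k A)) ->
  (forall r ds, foldr (fun d Q => P d /\ Q) True ds -> P (Infer r ds)) ->
  forall D, P D.
Proof.
move=> HA HI; fix IH 1; case=> [k A|r ds]; first exact: HA.
by apply: HI; elim: ds => //= d ds IHds; split.
Qed.

Definition models (S : signature) (s : nat -> term S) (us : seq (assumption S))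
    (G : seq (form S)) : Prop :=
  forall h, h \in us -> forces (psubst s h.2) G.

Lemma models_cat (S : signature) (s : nat -> term S) us vs G :
  models s (us ++ vs) G -> models s us G /\ models s vs G.
Proof. by move=> m; split=> h hu; apply: m; rewrite mem_cat hu ?orbT. Qed.

Lemma models_weak (S : signature) (s : nat -> term S) us G H :
  models s us G -> {subset G <= H} -> models s us H.
Proof. by move=> m sb h hu; apply: forces_weak (m h hu) sb. Qed.

Lemma models_discharge (S : signature) (s : nat -> term S) us hs G :
  models s [seq h <- us | h \notin hs] G -> models s hs G -> models s us G.
Proof.
move=> m mh h hu; case: (boolP (h \in hs)) => [/mh//|hn].
by apply: m; rewrite mem_filter hn.
Qed.

Lemma models_cons (S : signature) (s : nat -> term S) k A us G :
  forces (psubst s A) G -> models s us G -> models s ((k, A) :: us) G.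
Proof. by move=> f m h; rewrite inE => /predU1P[->|/m]. Qed.

(** The eigenparameter condition at work: the value of [a] is free to change because no assumption
    in [us] mentions [a]. *)
Lemma models_upd (S : signature) (s : nat -> term S) a t us G :
  fresh_in a us -> models s us G -> models (upd s a t) us G.
Proof. by move=> /allP fr m h hu; rewrite psubst_upd; [apply: m | apply: fr]. Qed.

Lemma deduction_formula (S : signature) (D : tree S) : deduction D -> formula (concl D).
Proof. by case: D => //= r ds /and4P[]. Qed.

(** The statement ranges over all [s] and [G] because rules with eigenparameters change [s] and
    discharging rules pass to larger worlds. *)
Lemma soundness (S : signature) (D : tree S) :
  deduction D ->
  forall s G, models s (undischarged D) G -> forces (psubst s (concl D)) G.
Proof.
elim/tree_nested_ind: D => [k A _ s G m|r ds IH].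
  by apply: (m (k, A)); rewrite mem_head.
(* For a premise without discharge the filter in [discharge] simplifies to the constant [true]. *)
have und0 U s G : models s [seq _ : assumption S <- U | true] G -> models s U G.
  by rewrite filter_predT.
case: r => [A B|A B|A B|A B|A B|A B C k l|A B k|A B|A B k l|A B|A B|A
  |x A a k|x A t|x A t|x A C a k l|t|x A t1 t2];
(* Lists with the wrong number of premises contradict the equation with [rule_prems]. *)
move: ds IH => [|d1 [|d2 [|d3 [|d4 ds]]]] //=;
try by [move=> _; rewrite andbF | move=> _ /andP[_ /andP[/eqP]]].
- move=> [I1 [I2 _]] /and3P[_ /eqP[c1 c2] /and3P[D1 D2 _]] s G.
  move=> /models_cat[/und0 m1 /models_cat[/und0 m2 _]].
  by split; [rewrite -c1; apply: I1|rewrite -c2; apply: I2].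
- move=> [I1 _] /and3P[_ /eqP[c1] /andP[D1 _]] s G /models_cat[/und0 m1 _].
  by have := I1 D1 s G m1; rewrite c1 => -[].
- move=> [I1 _] /and3P[_ /eqP[c1] /andP[D1 _]] s G /models_cat[/und0 m1 _].
  by have := I1 D1 s G m1; rewrite c1 => -[].
- move=> [I1 _] /and3P[_ /eqP[c1] /andP[D1 _]] s G /models_cat[/und0 m1 _].
  move: (I1 D1 s G m1); rewrite c1 => f H C sb; apply=> //; left.
  exact: force_weak f sb.
- move=> [I1 _] /and3P[_ /eqP[c1] /andP[D1 _]] s G /models_cat[/und0 m1 _].
  move: (I1 D1 s G m1); rewrite c1 => f H C sb; apply=> //; right.
  exact: force_weak f sb.
- move=> [I1 [I2 [I3 _]]] /and3P[_ /eqP[c1 c2 c3] /and4P[D1 D2 D3 _]] s G.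
  move=> /models_cat[/und0 m1 /models_cat[m2 /models_cat[m3 _]]].
  (* The disjunction yields only a cover; the case distinction is permitted because the goal is
     itself a forcing statement. *)
  have := I1 D1 s G m1; rewrite c1 => cv; apply: (cover_forces cv) => H sb [f|f].
    rewrite -c2; apply: I2 => //; apply: models_discharge (models_weak m2 sb) _.
    exact: models_cons.
  rewrite -c3; apply: I3 => //; apply: models_discharge (models_weak m3 sb) _.
  exact: models_cons.
- move=> [I1 _] /and3P[_ /eqP[c1] /andP[D1 _]] s G /models_cat[m1 _] H sb f.
  rewrite -/(forces _ H) -c1; apply: I1 => //.
  by apply: models_discharge (models_weak m1 sb) _; apply: models_cons.
- move=> [I1 [I2 _]] /and3P[_ /eqP[c1 c2] /and3P[D1 D2 _]] s G.
  move=> /models_cat[/und0 m1 /models_cat[/und0 m2 _]].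
  have := I1 D1 s G m1; rewrite c1; apply=> //.
  by have := I2 D2 s G m2; rewrite c2.
- move=> [I1 [I2 _]] /and3P[_ /eqP[c1 c2] /and3P[D1 D2 _]] s G.
  move=> /models_cat[m1 /models_cat[m2 _]] H sb; split=> f.
    rewrite -/(forces _ H) -c1; apply: I1 => //.
    by apply: models_discharge (models_weak m1 sb) _; apply: models_cons.
  rewrite -/(forces _ H) -c2; apply: I2 => //.
  by apply: models_discharge (models_weak m2 sb) _; apply: models_cons.
- move=> [I1 [I2 _]] /and3P[_ /eqP[c1 c2] /and3P[D1 D2 _]] s G.
  move=> /models_cat[/und0 m1 /models_cat[/und0 m2 _]].
  have := I1 D1 s G m1; rewrite c1 => /(_ G (fun x => id)) [f _]; apply: f.
  by have := I2 D2 s G m2; rewrite c2.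
- move=> [I1 [I2 _]] /and3P[_ /eqP[c1 c2] /and3P[D1 D2 _]] s G.
  move=> /models_cat[/und0 m1 /models_cat[/und0 m2 _]].
  have := I1 D1 s G m1; rewrite c1 => /(_ G (fun x => id)) [_ f]; apply: f.
  by have := I2 D2 s G m2; rewrite c2.
- move=> [I1 _] /and4P[fA /eqP[c1] aA /andP[D1 _]] s G /models_cat[/und0 m1 _].
  have := I1 D1 s G m1; rewrite c1 => p; rewrite forces_atomic ?atomic_psubst //.
  by apply: prf_botE_normal p; rewrite ?atomic_psubst ?formula_psubst.
- move=> [I1 _] /and4P[_ /eqP[c1] /andP[aA fr] /andP[D1 _]] s G /models_cat[m1 _] H t sb p.
  (* The eigenparameter is interpreted by the arbitrary existing term [t]. *)
  have := I1 D1 (upd s a t) H; rewrite c1 psubst_upd_subst // /forces shape_of_subst.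
  apply; apply: models_discharge (models_upd _ fr (models_weak m1 sb)) _.
  by apply: models_cons => //=; rewrite /upd eqxx.
- move=> [I1 [I2 _]] /and3P[_ /eqP[c1 c2] /and3P[D1 D2 _]] s G.
  move=> /models_cat[/und0 m1 /models_cat[/und0 m2 _]].
  rewrite psubst_subst; apply: forces_AllE.
    by have := I1 D1 s G m1; rewrite c1.
  by have := I2 D2 s G m2; rewrite c2.
- move=> [I1 [I2 _]] /and3P[_ /eqP[c1 c2] /and3P[D1 D2 _]] s G.
  move=> /models_cat[/und0 m1 /models_cat[/und0 m2 _]] H C sb; apply=> //.
  exists (tpsubst s t); split.
    by have := I2 D2 s G m2; rewrite c2 => p; apply: prf_weak p sb.
  have := I1 D1 s G m1; rewrite c1 psubst_subst /forces shape_of_subst => f.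
  exact: force_weak f sb.
- move=> [I1 [I2 _]] /and4P[_ /eqP[c1 c2] /and3P[aA aC fr] /and3P[D1 D2 _]] s G.
  move=> /models_cat[/und0 m1 /models_cat[m2 _]].
  have := I1 D1 s G m1; rewrite c1 => cv.
  apply: (cover_forces cv) => H sb [t [p f]].
  (* The eigenparameter is interpreted by the witness [t] that the cover provides. *)
  have := I2 D2 (upd s a t) H; rewrite c2 psubst_upd //; apply.
  apply: models_discharge (models_upd _ fr (models_weak m2 sb)) _.
  apply: models_cons; first by rewrite psubst_upd_subst // /forces shape_of_subst.
  by apply: models_cons => //=; rewrite /upd eqxx.
- by move=> _ _ s G _; apply: prf_eqI.
- move=> [I1 [I2 _]] /and4P[_ /eqP[c1 c2] /andP[aA n] /and3P[D1 D2 _]] s G.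
  move=> /models_cat[/und0 m1 /models_cat[/und0 m2 _]].
  have := I1 D1 s G m1; rewrite c1 => p.
  have := I2 D2 s G m2; rewrite c2 !psubst_subst.
  rewrite !forces_atomic ?atomic_subst ?atomic_psubst //.
  by apply: prf_eqE_normal p; rewrite atomic_psubst.
Qed.

(** * From [prf] to deduction trees *)

(** Together with the formulas in [G], the explicit [formula] hypotheses of [prf] vouch for every
    conclusion, as [deduction] checks each one. *)
Lemma prf_formula (S : signature) b (G : seq (form S)) A :
  prf b G A -> all (@formula S) G -> formula A.
Proof.
elim=> {b G A} //=.
- by move=> G A AG /allP; apply.
- by move=> G A B _ IH /IH; rewrite formula_And => /andP[].
- by move=> G A B _ IH /IH; rewrite formula_And => /andP[].
- by move=> G A B _ IH _ _ /IH; rewrite formula_Imp => /andP[].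
- by move=> G A B _ IH _ _ /IH; rewrite formula_Iff => /andP[].
- by move=> G A B _ IH _ _ /IH; rewrite formula_Iff => /andP[].
- by move=> G x A t _ IH _ _ /IH; rewrite formula_subst.
- by move=> G x A t1 t2 _ _ _ _ _ IH /IH; rewrite !formula_subst.
- by move=> G A B _ IA _ IB fG; rewrite formula_And IA // IB.
- by move=> G A B fB _ IA fG; rewrite formula_Or IA.
- by move=> G A B fA _ IB fG; rewrite formula_Or IB ?fA.
- by move=> G A B fA _ IB fG; rewrite formula_Imp IB fA.
- by move=> G A B fA fB *; rewrite formula_Iff fA.
(* The premise is available only for parameters outside [L], so one of these is chosen. *)
- move=> G L x A _ IH fG; have [a aL] := ex_fresh L.
  by have := IH a aL fG; rewrite formula_subst.
- by move=> G x A t _ IH _ _ /IH; rewrite formula_subst.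
- move=> G A B C _ IH _ I1 _ _ fG; apply: I1.
  by have := IH fG; rewrite formula_Or fG andbT => /andP[].
- move=> G L x A C _ IH _ IC fG; have [a aL] := ex_fresh L; apply: (IC a aL).
  by rewrite fG formula_subst -formula_Ex IH.
Qed.

(** * Normality as a local condition on trees *)

Definition neutral_root (S : signature) (D : tree S) : bool :=
  if D is Infer r _ then is_elim r && ~~ is_del r else true.

(** A major premise with a neutral root is concluded neither by an introduction rule, which excludes
    maximal formulas, nor by a del-rule, which excludes maximal segments. *)
Fixpoint neutral_majors (S : signature) (D : tree S) : bool :=
  if D is Infer r ds then
    (is_intro r || (if ds is d :: _ then neutral_root d else true))
      && all (@neutral_majors S) ds
  else true.

Lemma neutral_majors_subtree (S : signature) (D D' : tree S) p :
  neutral_majors D -> subtree D p = Some D' -> neutral_majors D'.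
Proof.
elim: p D => [|i p IH] [k A|r ds] //=; try by move=> ? [<-].
move=> /andP[_ nds]; elim: ds nds i => [_ [] //|d ds IHds /= /andP[nd nds] [|i]] /=.
  exact: IH.
exact: IHds.
Qed.

(** Paths are read from the root, whereas passing to a premise extends them at the far end. *)
Lemma subtree_rcons (S : signature) (D : tree S) p i :
  subtree D (rcons p i) = obind (fun d => subtree d [:: i]) (subtree D p).
Proof.
elim: p D => [|j p IH] [k A|r ds] //=.
by case: (onth ds j) => //= d; rewrite IH.
Qed.

Lemma major_premise_neutral_root (S : signature) (D : tree S) p :
  neutral_majors D -> major_premise D p ->
  forall D', subtree D p = Some D' -> neutral_root D'.
Proof.
move=> nD [q -> ]; rewrite /concluded_by => eq D'; rewrite subtree_rcons.
case E: (subtree D q) eq => [[k A|r [|d ds]]|] //= er [<-].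
have := neutral_majors_subtree nD E => /= /andP[].
by move: er; rewrite /is_elim => /negbTE ->.
Qed.

Lemma neutral_majors_normal (S : signature) (D : tree S) :
  neutral_majors D -> normal D.
Proof.
move=> nD; split=> [p [c mp]|s [[s1 _ _ _ chain] mp]].
  have := major_premise_neutral_root nD mp; move: c; rewrite /concluded_by.
  case: (subtree D p) => [[k A|r ds]|] //= c /(_ _ erefl) /=.
  by rewrite /is_elim c.
have := major_premise_neutral_root nD mp.
(* A segment has at least two members, so index [(size s).-2] is its last but one, and the chain
   makes its last one the conclusion of a del-rule. *)
have [_ _] : exists2 j, nth [::] s (size s).-2 = rcons (last [::] s) j.+1
    & concluded_by D (last [::] s) (@is_del S).
  have := chain (size s).-2; case: s s1 {chain mp} => [|p [|q s]] //= _.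
  by move/(_ (ltnSn _)); rewrite (last_nth [::]).
rewrite /concluded_by.
case: (subtree D _) => [[k A|r ds]|] //= c /(_ _ erefl) /=.
by rewrite c andbF.
Qed.

(* All assumptions carry the label 0: an application then discharges every
   occurrence of the formula, which is harmless. *)
Definition within (S : signature) (G : seq (form S)) (us : seq (assumption S)) :
    Prop :=
  forall h, h \in us -> h.1 = 0 /\ h.2 \in G.

Lemma within_nil (S : signature) (G : seq (form S)) : within G [::].
Proof. by []. Qed.

Lemma within_cat (S : signature) (G : seq (form S)) us vs :
  within G us -> within G vs -> within G (us ++ vs).
Proof. by move=> wu wv h; rewrite mem_cat => /orP[/wu|/wv]. Qed.

(** [As] lists the formulas discharged at one premise; the empty list handles premises without
    discharge. *)
Lemma within_discharge (S : signature) As (G : seq (form S)) us :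
  within (As ++ G) us ->
  within G [seq h <- us | h \notin [seq (0, A) | A <- As]].
Proof.
move=> w [k A]; rewrite mem_filter => /andP[n /w /= [k0]]; rewrite mem_cat.
case/orP=> // AA; case/negP: n; rewrite k0; exact: map_f.
Qed.

Lemma within_fresh (S : signature) a (G : seq (form S)) us :
  within G us -> a \notin flatten [seq pars A | A <- G] -> fresh_in a us.
Proof.
move=> w aG; apply/allP => h /w [_ hG]; apply: contra aG => ah.
by apply/flatten_mapP; exists h.2.
Qed.

(** The flag [b] survives as [neutral_root], which [neutral_majors] demands of a tree that becomes
    the deduction of a major premise. *)
Lemma prf_tree (S : signature) b (G : seq (form S)) A :
  prf b G A -> all (@formula S) G ->
  exists D, [/\ deduction D, neutral_majors D, concl D = A,
    within G (undischarged D) & b -> neutral_root D].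
Proof.
have und0 H us : within H us -> within H [seq h : assumption S <- us | h \notin [::]].
  exact: (@within_discharge _ [::]).
have w0 := @within_nil S.
move=> p; elim: p => {b G A}.
- move=> G A AG /allP fG; exists (Assume 0 A); split=> //=; first exact: fG.
  by move=> h; rewrite inE => /eqP->.
- move=> G A B p IH fG; have [D [dD nD cD wD rD]] := IH fG.
  exists (Infer (AndE1 A B) [:: D]); split=> //=.
  + by rewrite cD eqxx dD (prf_formula (prf_andE1 p)).
  + by rewrite rD // nD.
  + exact/within_cat/w0/und0.
- move=> G A B p IH fG; have [D [dD nD cD wD rD]] := IH fG.
  exists (Infer (AndE2 A B) [:: D]); split=> //=.
  + by rewrite cD eqxx dD (prf_formula (prf_andE2 p)).
  + by rewrite rD // nD.
  + exact/within_cat/w0/und0.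
- move=> G A B p IH q IH' fG; have [D [dD nD cD wD rD]] := IH fG.
  have [D' [dD' nD' cD' wD' _]] := IH' fG.
  exists (Infer (ImpE A B) [:: D; D']); split=> //=.
  + by rewrite cD cD' eqxx dD dD' (prf_formula (prf_impE p q)).
  + by rewrite rD // nD nD'.
  + by apply/within_cat/within_cat/w0/und0 => //; apply/und0.
- move=> G A B p IH q IH' fG; have [D [dD nD cD wD rD]] := IH fG.
  have [D' [dD' nD' cD' wD' _]] := IH' fG.
  exists (Infer (IffE1 A B) [:: D; D']); split=> //=.
  + by rewrite cD cD' eqxx dD dD' (prf_formula (prf_iffE1 p q)).
  + by rewrite rD // nD nD'.
  + by apply/within_cat/within_cat/w0/und0 => //; apply/und0.
- move=> G A B p IH q IH' fG; have [D [dD nD cD wD rD]] := IH fG.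
  have [D' [dD' nD' cD' wD' _]] := IH' fG.
  exists (Infer (IffE2 A B) [:: D; D']); split=> //=.
  + by rewrite cD cD' eqxx dD dD' (prf_formula (prf_iffE2 p q)).
  + by rewrite rD // nD nD'.
  + by apply/within_cat/within_cat/w0/und0 => //; apply/und0.
- move=> G A aA fA p IH fG; have [D [dD nD cD wD rD]] := IH fG.
  exists (Infer (BotE A) [:: D]); split=> //=.
  + by rewrite cD eqxx dD fA aA.
  + by rewrite rD // nD.
  + exact/within_cat/w0/und0.
- move=> G x A t p IH q IH' fG; have [D [dD nD cD wD rD]] := IH fG.
  have [D' [dD' nD' cD' wD' _]] := IH' fG.
  exists (Infer (AllE x A t) [:: D; D']); split=> //=.
  + by rewrite cD cD' eqxx dD dD' (prf_formula (prf_allE p q)).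
  + by rewrite rD // nD nD'.
  + by apply/within_cat/within_cat/w0/und0 => //; apply/und0.
- move=> G x A t1 t2 aA n p IH q IH' fG; have [D [dD nD cD wD rD]] := IH fG.
  have [D' [dD' nD' cD' wD' _]] := IH' fG.
  exists (Infer (EqE x A t1 t2) [:: D; D']); split=> //=.
  + by rewrite cD cD' eqxx dD dD' aA n (prf_formula (prf_eqE aA n p q)).
  + by rewrite rD // nD nD'.
  + by apply/within_cat/within_cat/w0/und0 => //; apply/und0.
- move=> G A _ IH fG; have [D [dD nD cD wD _]] := IH fG.
  by exists D.
- move=> G A B p IH q IH' fG; have [D [dD nD cD wD rD]] := IH fG.
  have [D' [dD' nD' cD' wD' _]] := IH' fG.
  exists (Infer (AndI A B) [:: D; D']); split=> //=.
  + by rewrite cD cD' eqxx dD dD' (prf_formula (prf_andI p q)).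
  + by rewrite nD nD'.
  + by apply/within_cat/within_cat/w0/und0 => //; apply/und0.
- move=> G A B fB p IH fG; have [D [dD nD cD wD rD]] := IH fG.
  exists (Infer (OrI1 A B) [:: D]); split=> //=.
  + by rewrite cD eqxx dD (prf_formula (prf_orI1 fB p)).
  + by rewrite nD.
  + exact/within_cat/w0/und0.
- move=> G A B fA p IH fG; have [D [dD nD cD wD rD]] := IH fG.
  exists (Infer (OrI2 A B) [:: D]); split=> //=.
  + by rewrite cD eqxx dD (prf_formula (prf_orI2 fA p)).
  + by rewrite nD.
  + exact/within_cat/w0/und0.
- move=> G A B fA p IH fG; have [|D [dD nD cD wD rD]] := IH; first by rewrite /= fA.
  exists (Infer (ImpI A B 0) [:: D]); split=> //=.
  + by rewrite cD eqxx dD (prf_formula (prf_impI fA p)).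
  + by rewrite nD.
  + exact/within_cat/w0/(@within_discharge _ [:: A]).
- move=> G A B fA fB p IH q IH' fG.
  have [|D [dD nD cD wD rD]] := IH; first by rewrite /= fA.
  have [|D' [dD' nD' cD' wD' _]] := IH'; first by rewrite /= fB.
  exists (Infer (IffI A B 0 0) [:: D; D']); split=> //=.
  + by rewrite cD cD' eqxx dD dD' (prf_formula (prf_iffI fA fB p q)).
  + by rewrite nD nD'.
  + apply/within_cat/within_cat/w0; first exact: (@within_discharge _ [:: A]).
    exact: (@within_discharge _ [:: B]).
- move=> G L x A p IH fG.
  (* One parameter outside [L] suffices; avoiding [A] and [G] as well secures the side condition of
     [AllI]. *)
  have [a] := ex_fresh (L ++ pars A ++ flatten [seq pars B | B <- G]).
  rewrite !mem_cat !negb_or => /and3P[aL aA aG].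
  have [//|D [dD nD cD wD rD]] := IH a aL.
  have w := within_discharge (As := [:: _]) wD.
  exists (Infer (AllI x A a 0) [:: D]); split=> //=.
  + by rewrite cD eqxx dD aA (within_fresh w aG) (prf_formula (prf_allI p)).
  + by rewrite nD.
  + exact/within_cat/w0.
- move=> G x A t p IH q IH' fG; have [D [dD nD cD wD rD]] := IH fG.
  have [D' [dD' nD' cD' wD' _]] := IH' fG.
  exists (Infer (ExI x A t) [:: D; D']); split=> //=.
  + by rewrite cD cD' eqxx dD dD' (prf_formula (prf_exI p q)).
  + by rewrite nD nD'.
  + by apply/within_cat/within_cat/w0/und0 => //; apply/und0.
- by move=> G t fG; exists (Infer (EqI t) [::]).
- move=> G A B C p IH q1 IH1 q2 IH2 fG; have [D [dD nD cD wD rD]] := IH fG.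
  have := prf_formula p fG; rewrite formula_Or => /andP[fA fB].
  have [|D1 [dD1 nD1 cD1 wD1 _]] := IH1; first by rewrite /= fA.
  have [|D2 [dD2 nD2 cD2 wD2 _]] := IH2; first by rewrite /= fB.
  exists (Infer (OrE A B C 0 0) [:: D; D1; D2]); split=> //=.
  + by rewrite cD cD1 cD2 eqxx dD dD1 dD2 (prf_formula (prf_orE p q1 q2)).
  + by rewrite rD // nD nD1 nD2.
  + apply/within_cat/within_cat/within_cat/w0; first exact: und0.
      exact: (@within_discharge _ [:: A]).
    exact: (@within_discharge _ [:: B]).
- move=> G L x A C p IH q IH' fG; have [D [dD nD cD wD rD]] := IH fG.
  have [a] := ex_fresh (L ++ pars A ++ pars C ++ flatten [seq pars B | B <- G]).
  rewrite !mem_cat !negb_or => /and4P[aL aA aC aG].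
  have [|D' [dD' nD' cD' wD' _]] := IH' a aL.
    by rewrite /= fG formula_subst -formula_Ex (prf_formula p fG).
  (* Two classes are discharged, the instance of [A] and the existence of [a]; the freshness of [a]
     concerns only what remains. *)
  have w := within_discharge (As := [:: _; _]) wD'.
  exists (Infer (ExE x A C a 0 0) [:: D; D']); split=> //=.
  + by rewrite cD cD' eqxx dD dD' aA aC (within_fresh w aG) (prf_formula (prf_exE p q)).
  + by rewrite rD // nD nD'.
  + by apply/within_cat/within_cat/w0/w; apply: und0.
Qed.

(** Undischarged assumptions are leaves, where [deduction] tests [formula] directly. *)
Lemma undischarged_formula (S : signature) (D : tree S) h :
  deduction D -> h \in undischarged D -> formula h.2.
Proof.
elim/tree_nested_ind: D h => [k A h fA|r ds IH h /= /and4P[_ _ _ dds]].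
  by rewrite inE => /eqP->.
rewrite /discharge; elim: ds (rule_disch r) IH dds => [|d ds IHds] [|hs hss] //=.
move=> [Id Ids] /andP[dd dds]; rewrite mem_cat mem_filter => /orP[/andP[_]|].
  exact: Id.
exact: IHds.
Qed.

Theorem theorem1 (S : signature) (D : tree S) (hD : deduction D) :
  exists D' : tree S,
    [/\ deduction D',
        normal D',
        concl D' = concl D
      & {subset undischarged_formulas D' <= undischarged_formulas D}].
Proof.
have fG : all (@formula S) (undischarged_formulas D).
  by apply/allP => A /mapP[h hu ->]; apply: undischarged_formula hD hu.
have p : prf false (undischarged_formulas D) (concl D).
  apply: forces_prf; first exact: deduction_formula.
  (* [Par] is the identity substitution, and each undischarged assumption is forced in this world by
     reflection. *)
  rewrite -[concl D]psubst_id; apply: soundness => // h hu.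
  rewrite psubst_id; apply: prf_forces; first exact: undischarged_formula hD hu.
  exact/prf_assume/map_f.
have [D' [dD' nD' cD' wD' _]] := prf_tree p fG.
exists D'; split=> //; first exact: neutral_majors_normal.
by move=> A /mapP[h /wD' [_ hG] ->].
Qed.
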